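(* Let $r$ be a (possibly non-smooth and nonconvex) function on $m\times n$ real matrices of the form $r(\mathbf{X})=\sum_{i=1}^m\hat r(\sigma_i(\mathbf{X}))$, where $\hat r(0)=0$ and $\hat r(\alpha)$ is concave and non-decreasing for $\alpha\ge 0$. Let $\mu>0$, let $\mathbf{Z}\in\mathbb{R}^{m\times n}$, and let $$y_i^*\in \operatorname{Arg\,min}_{y_i\ge 0}\ \tfrac12\left(y_i-\sigma_i(\mathbf{Z})\right)^2+\mu\,\hat r(y_i).$$ There exists a threshold $\gamma>0$ such that $y_i^*=0$ when $\sigma_i(\mathbf{Z})\le\gamma$.
   Context: $\sigma_i(\mathbf{Z})$ denotes the $i$-th leading (largest) singular value of $\mathbf{Z}$. The numbers $y_i^*$ give the proximal operator of $\mu r$ at $\mathbf{Z}$: if $\mathbf{U}\mathbf{\Sigma}\mathbf{V}^\top$ is the SVD of $\mathbf{Z}$, then $\operatorname{prox}_{\mu r}(\mathbf{Z})=\mathbf{U}\,\mathrm{Diag}(\mathbf{y}^* )\mathbf{V}^\top$ with $\mathbf{y}^*=[y_i^*]$, where $\operatorname{prox}_{\mu r}(\mathbf{Z})=\operatorname{Arg\,min}_{\mathbf{X}}\frac12\|\mathbf{X}-\mathbf{Z}\|_F^2+\mu r(\mathbf{X})$ and $\|\cdot\|_F$ is the Frobenius norm. The paper describes the threshold $\gamma$ as regularizer-specific.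
   Formalization: For a threshold γ depending only on the regularizer and μ (not on Z), r̂ is assumed not identically zero on α ≥ 0, since for r̂ = 0 one has y_i* = σ_i(Z) and no such γ exists; with γ allowed to depend on Z and y*, the claim is stated for every r̂. *)

(* Defs.v *)
From HB Require Import structures.
From mathcomp Require Import all_boot all_order all_algebra.
From mathcomp Require Import polyrcf.
From mathcomp Require Import all_classical all_reals all_analysis.

Set Implicit Arguments.
Unset Strict Implicit.
Unset Printing Implicit Defensive.

Import Order.TTheory GRing.Theory Num.Theory.
Local Open Scope ring_scope.
Local Open Scope classical_set_scope.

(* The real roots of p, each repeated according to its multiplicity. *)
Definition real_roots (R : realType) (p : {poly R}) : seq R :=
  flatten [seq nseq (mup x p) x | x <- rootsR p].

(* The square roots of the m eigenvalues of Z Z^T (counted with multiplicity)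
   in non-increasing order; if n < m the last m - n of them are 0. *)
Definition singular_values (R : realType) (m n : nat) (Z : 'M[R]_(m, n)) :
    seq R :=
  sort >=%O [seq Num.sqrt x | x <- real_roots (char_poly (Z *m Z^T))].

(* Indices start at 0: the largest singular value has index 0. *)
Definition singular_value (R : realType) (m n : nat) (Z : 'M[R]_(m, n))
    (i : 'I_m) : R :=
  nth 0 (singular_values Z) i.

Definition concave_on (R : realType) (D : set R) (f : R -> R) : Prop :=
  convex_function (E := R^o) D (fun x => - f x).

Definition argmin_on (R : realType) (T : Type) (D : set T) (f : T -> R) :
    set T :=
  [set y | D y /\ forall x, D x -> f y <= f x].

(* U Diag(s) V^T is a singular value decomposition of Z. *)
Definition is_svd (R : realType) (m n : nat) (Z : 'M[R]_(m, n))
    (U : 'M[R]_m) (s : 'I_m -> R) (V : 'M[R]_n) : Prop :=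
  [/\ U^T *m U = 1%:M, V^T *m V = 1%:M,
      (forall i, 0 <= s i) /\ (forall i : 'I_m, (n <= i)%N -> s i = 0),
      {homo s : i j / (i <= j)%N >-> j <= i}
    & Z = U *m (\matrix_(i, j) (s i *+ (i == j :> nat))) *m V^T].

Lemma perm_real_roots (R : realType) (t : seq R) :
  perm_eq (real_roots (\prod_(x <- t) ('X - x%:P))) t.
Proof.
set p := \prod_(x <- t) _.
have p0 : p != 0 by rewrite monic_neq0 ?monic_prod_XsubC.
have mem_rt x : (x \in rootsR p) = (x \in t).
  by rewrite -roots_on_rootsR // in_itv /= root_prod_XsubC.
have uniq_rt : uniq (rootsR p).
  exact: (sorted_uniq lt_trans ltxx (sorted_roots _ _ _)).
rewrite /perm_eq; apply/allP => a _ /=; apply/eqP.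
rewrite /real_roots count_flatten -map_comp sumnE big_map.
under eq_bigr => x _ do rewrite /= count_nseq /= mu_prod_XsubC.
have [at_|at_] := boolP (a \in t); last first.
  rewrite (count_memPn at_) big_seq big1 // => x; rewrite mem_rt => xt.
  by rewrite (negbTE (memPn at_ _ xt)).
rewrite (bigD1_seq a) ?mem_rt //= eqxx mul1n big1 ?addn0 // => x xa.
by rewrite (negbTE xa).
Qed.

Lemma char_poly_ortho_conj (R : comNzRingType) (m : nat) (U M : 'M[R]_m) :
  U^T *m U = 1%:M -> char_poly (U *m M *m U^T) = char_poly M.
Proof.
move=> UU; have UU' := mulmx1C UU.
rewrite /char_poly; set P := map_mx (@polyC R) U.
have PP : P *m P^T = 1%:M by rewrite map_trmx -map_mxM UU' map_mx1.
have -> : char_poly_mx (U *m M *m U^T) = P *m char_poly_mx M *m P^T.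
  rewrite /char_poly_mx !map_mxM -map_trmx mulmxBr mulmxBl; congr (_ - _).
  by rewrite scalar_mxC -mulmxA PP mulmx1.
by rewrite !det_mulmx mulrAC -det_mulmx PP det1 mul1r.
Qed.

Lemma singular_value_svd (R : realType) (m n : nat) (Z : 'M[R]_(m, n))
    (U : 'M[R]_m) (s : 'I_m -> R) (V : 'M[R]_n) :
  is_svd Z U s V -> singular_value Z =1 s.
Proof.
case=> UU VV [s0 sn] smono defZ i.
set D : 'M[R]_(m, n) := \matrix_(_, _) _ in defZ.
have DD : D *m D^T = diag_mx (\row_j (s j ^+ 2)).
  apply/matrixP => a b; rewrite !mxE.
  have [an|na] := ltnP a n; last first.
    rewrite big1; last by move=> j _; rewrite !mxE sn // mul0rn mul0r.
    by rewrite sn // expr0n /= mul0rn.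
  rewrite (bigD1 (Ordinal an)) //= big1 => [|j ja]; last first.
    rewrite !mxE (_ : (a == j :> nat) = false) ?mul0r //.
    by apply/negbTE; apply: contraNneq ja => aj; apply/eqP/val_inj.
  rewrite !mxE /= eqxx addr0 mulr1n expr2 -(inj_eq val_inj a b) /=.
  rewrite eq_sym; case: eqP => [/val_inj->|_]; first by rewrite !mulr1n.
  by rewrite !mulr0n mulr0.
rewrite /singular_value.
have -> : singular_values Z = [seq s j | j <- enum 'I_m]; last first.
  by rewrite (nth_map i) ?size_enum_ord // nth_ord_enum.
apply: (@sorted_eq _ >=%O).
- exact: ge_trans.
- by move=> x y; rewrite andbC; exact: le_anti.
- exact: sort_sorted ge_total _.
- rewrite sorted_map.
  have : sorted (relpre val leq) (enum 'I_m).
    by rewrite -sorted_map val_enum_ord iota_sorted.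
  by apply: sub_sorted => j k /smono.
rewrite perm_sort.
have -> : char_poly (Z *m Z^T)
    = \prod_(x <- [seq s j ^+ 2 | j <- enum 'I_m]) ('X - x%:P).
  have -> : Z *m Z^T = U *m (D *m D^T) *m U^T.
    rewrite defZ !trmx_mul trmxK !mulmxA; congr (_ *m _ *m _).
    by rewrite -[_ *m V^T *m V]mulmxA VV mulmx1.
  rewrite char_poly_ortho_conj // DD char_poly_trig ?diag_mx_is_trig //.
  rewrite big_map big_enum /=.
  by apply: eq_bigr => j _; rewrite !mxE eqxx.
apply: (perm_trans (perm_map _ (perm_real_roots _))).
rewrite -map_comp.
suff /eq_map -> : Num.sqrt \o (fun j => s j ^+ 2) =1 s by [].
by move=> j /=; rewrite sqrtr_sqr ger0_norm.
Qed.

(* Main.v *)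
(* Comparing the minimiser y >= 0 for sigma with the competitor 0 gives
   y^2 / 2 + mu rhat(y) <= y sigma.  As rhat >= 0, this yields y <= 2 sigma, so
   y = 0 as soon as sigma <= 0: for a fixed Z, any gamma below its positive
   singular values works.  If rhat(a) > 0 for some a > 0, then concavity gives
   rhat(y) >= (rhat(a) / a) y on [0, a]; for sigma <= a / 2 we have y <= a,
   hence y > 0 would force sigma > mu rhat(a) / a, and
   gamma = min(a / 2, mu rhat(a) / a) is uniform in Z. *)
Require Import Defs.
From HB Require Import structures.
From mathcomp Require Import all_boot all_order all_algebra.
From mathcomp Require Import all_classical all_reals all_analysis.
From mathcomp Require Import lra.

Import Order.TTheory GRing.Theory Num.Theory.
Local Open Scope ring_scope.
Local Open Scope classical_set_scope.

(** Concavity is applied to [t] as the convex combination of [a] and [0] with weight [t / a] on [a];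
    multiplying by [a] clears the denominator. *)
Lemma concave_on_chord {R : realType} {f : R -> R} {a t : R} :
  concave_on [set x : R | 0 <= x] f -> f 0 = 0 ->
  0 < a -> 0 <= t -> t <= a -> t * f a <= a * f t.
Proof.
move=> cf f0 a0 t0 ta.
have p0 : 0 <= t / a by rewrite divr_ge0 // ltW.
have p1 : t / a <= 1 by rewrite ler_pdivrMr // mul1r.
have := cf (Itv01 p0 p1) a 0.
rewrite !inE /= => /(_ (ltW a0) (lexx 0)).
have -> : conv (Itv01 p0 p1) (a : convex_lmodType R^o) 0 = t.
  by rewrite /conv /= scaler0 addr0 -[_ *: _]/(_ * _) divfK ?gt_eqF.
rewrite convRE /= f0 oppr0 mulr0 addr0 mulrN lerN2.
by rewrite mulrAC ler_pdivrMr // mulrC (mulrC (f t)).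
Qed.

Lemma exists_pos_le_imp_le0 {R : realFieldType} {I : finType} (s : I -> R) :
  exists2 g : R, 0 < g & forall i, s i <= g -> s i <= 0.
Proof.
(* Half the least positive value lies strictly below every positive [s i]; the default [1] keeps it
   positive when there are none. *)
exists (\big[Order.min/1]_(i | 0 < s i) s i / 2) => [|i].
  by rewrite divr_gt0 //; apply: lt_bigmin.
case: (lerP (s i) 0) => // si0.
have : \big[Order.min/1]_(j | 0 < s j) s j <= s i by exact: bigmin_le_cond.
by set g := \big[_/_]_(_ | _) _; lra.
Qed.

Lemma argmin_prox_le {R : realType} {f : R -> R} {mu s y : R} :
  f 0 = 0 ->
  argmin_on [set t : R | 0 <= t]
    (fun t => 2^-1 * (t - s) ^+ 2 + mu * f t) y ->
  0 <= y /\ 2^-1 * y ^+ 2 + mu * f y <= y * s.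
Proof.
by move=> f0 [/= y0 /(_ 0 (lexx 0))]; rewrite f0; split=> //; nra.
Qed.

Theorem proposition3p1 (R : realType) (m n : nat)
    (r : 'M[R]_(m, n) -> R) (rhat : R -> R) (mu : R)
    (hr : forall X : 'M[R]_(m, n),
      r X = \sum_(i < m) rhat (singular_value X i))
    (rhat0 : rhat 0 = 0)
    (rhat_concave : concave_on [set a : R | 0 <= a] rhat)
    (rhat_nondecreasing : forall a b : R, 0 <= a -> a <= b -> rhat a <= rhat b)
    (mu_gt0 : 0 < mu) :
  (* for every Z and y, with no condition on rhat besides the above *)
  (forall (Z : 'M[R]_(m, n)) (y : 'I_m -> R),
     (forall i : 'I_m, argmin_on [set t : R | 0 <= t]
        (fun t => 2^-1 * (t - singular_value Z i) ^+ 2 + mu * rhat t) (y i)) ->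
     exists2 gamma : R, 0 < gamma &
       forall i : 'I_m, singular_value Z i <= gamma -> y i = 0)
  /\
  (* regularizer-specific gamma, uniform in Z and y; such a gamma does not
     exist when rhat vanishes identically *)
  ((exists2 a : R, 0 <= a & rhat a != 0) ->
   exists2 gamma : R, 0 < gamma &
     forall (Z : 'M[R]_(m, n)) (y : 'I_m -> R),
       (forall i : 'I_m, argmin_on [set t : R | 0 <= t]
          (fun t => 2^-1 * (t - singular_value Z i) ^+ 2 + mu * rhat t) (y i)) ->
       forall i : 'I_m, singular_value Z i <= gamma -> y i = 0).
Proof.
have rhat_ge0 (t : R) : 0 <= t -> 0 <= rhat t.
  by move=> t0; rewrite -rhat0 rhat_nondecreasing.
have y_le (s y : R) :
    0 < y -> 2^-1 * y ^+ 2 + mu * rhat y <= y * s -> y <= 2 * s.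
  move=> y_gt0 yle; rewrite -(ler_pM2l y_gt0).
  have : 0 <= mu * rhat y by rewrite mulr_ge0 ?rhat_ge0 // ltW.
  by lra.
split=> [Z y ymin|[a a0 ra0]].
  have [g g0 sg] := exists_pos_le_imp_le0 (singular_value Z).
  exists g => // i /sg si0; apply/eqP; apply: contraT => yn0.
  have [y0 yle] := argmin_prox_le rhat0 (ymin i).
  have y_gt0 : 0 < y i by rewrite lt_def yn0.
  by have := y_le _ _ y_gt0 yle; lra.
have a_gt0 : 0 < a.
  by rewrite lt_def a0 andbT; apply: contraNneq ra0 => ->; rewrite rhat0.
have ra_gt0 : 0 < rhat a by rewrite lt_def ra0 rhat_ge0.
exists (Order.min (a / 2) (mu * rhat a / a)) => [|Z y ymin i].
  by rewrite lt_min !divr_gt0 // mulr_gt0.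
rewrite le_min !ler_pdivlMr // => /andP[sa sc].
apply/eqP; apply: contraT => yn0.
have [y0 yle] := argmin_prox_le rhat0 (ymin i).
have y_gt0 : 0 < y i by rewrite lt_def yn0.
have ya : y i <= a by have := y_le _ _ y_gt0 yle; lra.
have chord := concave_on_chord rhat_concave rhat0 a_gt0 y0 ya.
(* With everything scaled by [a] and [y i], the terms in [rhat (y i)] cancel, leaving
   [a * y i ^+ 2 / 2 <= 0], a contradiction. *)
have : mu * (y i * rhat a) <= mu * (a * rhat (y i)) by rewrite ler_pM2l.
have : y i * (singular_value Z i * a) <= y i * (mu * rhat a) by rewrite ler_pM2l.
have : a * (2^-1 * y i ^+ 2 + mu * rhat (y i)) <= a * (y i * singular_value Z i).
  by rewrite ler_pM2l.
have : 0 < a * (y i ^+ 2) by rewrite mulr_gt0 ?exprn_gt0.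
lra.
Qed.
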